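(* Let $X$ be an infinite compact metric space and $f:X\to X$ a continuous map such that $(X,f)$ has the gluing orbit property. The following are equivalent: (1) $(X,f)$ has zero topological entropy. (2) $(X,f)$ is minimal. (3) $(X,f)$ is equicontinuous. (4) $(X,f)$ is uniformly rigid. (5) $(X,f)$ is uniquely ergodic.
   Context: $\mathbb{Z}^+$ is the set of positive integers and $\mathbb{N}=\mathbb{Z}^+\cup\{0\}$. Let $(X,d)$ be a compact metric space and $f:X\to X$ continuous. Gluing orbit property: an orbit sequence is a sequence $\{(x_j,m_j)\}_{j\in\mathbb{Z}^+}$ in $X\times\mathbb{Z}^+$; a gap is a sequence $\{t_j\}_{j\in\mathbb{Z}^+}$ of positive integers. For $\varepsilon>0$, the pair (orbit sequence, gap) is $\varepsilon$-traced by $z\in X$ if for every $j\in\mathbb{Z}^+$, $d(f^{s_j+l}(z),f^l(x_j))\le\varepsilon$ for each $l=0,1,\dots,m_j-1$, where $s_1=0$ and $s_j=\sum_{i=1}^{j-1}(m_i+t_i-1)$ for $j\ge2$. $(X,f)$ has the gluing orbit property if for every $\varepsilon>0$ there is $M=M(\varepsilon)\in\mathbb{Z}^+$ such that for any orbit sequence there is a gap in $\{1,\dots,M\}^{\mathbb{Z}^+}$ such that the pair is $\varepsilon$-traced by some point of $X$. $(X,f)$ is minimal if every forward orbit $\{f^n(x):n\in\mathbb{N}\}$ is dense in $X$. $(X,f)$ is equicontinuous if for every $\varepsilon>0$ there is $\delta>0$ such that $d(x,y)<\delta$ implies $d(f^n(x),f^n(y))<\varepsilon$ for every $n\in\mathbb{N}$.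 $(X,f)$ is uniformly rigid if there is a sequence $\{n_k\}_{k=1}^\infty$ of positive integers such that $\sup_{x\in X}d(f^{n_k}(x),x)\to0$ as $k\to\infty$. $(X,f)$ is uniquely ergodic if it has exactly one invariant Borel probability measure. *)

(* Defs.v *)
From HB Require Import structures.
From mathcomp Require Import all_boot all_order all_algebra finmap.
From mathcomp Require Import all_classical all_reals all_analysis.

Set Implicit Arguments.
Unset Strict Implicit.
Unset Printing Implicit Defensive.

Import Order.TTheory GRing.Theory Num.Theory.
Import numFieldNormedType.Exports.

Local Open Scope classical_set_scope.
Local Open Scope ring_scope.

(* [measurableType] requires a distinguished point, hence the pointed variant
   of [metricType]; the point plays no other role. *)
#[short(type="pmetricType")]
HB.structure Definition PointedMetric (K : numDomainType) :=
  { M of Metric K M & Pointed M }.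

Notation borel X := (g_sigma_algebraType (@open X)).

Section Dynamics.
Context {R : realType} {X : pmetricType R}.
Implicit Types (f : X -> X) (x : nat -> X) (m t : nat -> nat).

(* Sequences indexed by the positive integers are shifted to start at 0; the
   truncated subtraction is exact as soon as [m] or [t] is positive. *)
Definition trace_start m t (j : nat) : nat := (\sum_(i < j) (m i + t i - 1))%N.

Definition traced f (eps : R) x m t (z : X) : Prop :=
  forall j l : nat, (l < m j)%N ->
    mdist (iter (trace_start m t j + l) f z) (iter l f (x j)) <= eps.

Definition gluing_orbit f : Prop :=
  forall eps : R, 0 < eps ->
  exists2 M : nat, (0 < M)%N &
    forall x m, (forall j, (0 < m j)%N) ->
    exists t, (forall j, (0 < t j <= M)%N) /\ exists z, traced f eps x m t z.

Definition minimal_system f : Prop :=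
  forall x0 : X, dense (range (fun n => iter n f x0)).

Definition equicontinuous_system f : Prop :=
  forall eps : R, 0 < eps ->
  exists2 delta : R, 0 < delta &
    forall y z : X, mdist y z < delta ->
    forall n : nat, mdist (iter n f y) (iter n f z) < eps.

Definition uniformly_rigid f : Prop :=
  exists2 n : nat -> nat, (forall k, (0 < n k)%N) &
    ereal_sup (range (fun y : X => (mdist (iter (n k) f y) y)%:E))
      @[k --> \oo] --> 0%E.

Definition invariant_measure f (mu : probability (borel X) R) : Prop :=
  forall A : set (borel X), measurable A -> mu (f @^-1` A) = mu A.

(* A measure is a total function on [set (borel X)] whose values are constrained
   only on measurable sets, so uniqueness is stated on measurable sets. *)
Definition uniquely_ergodic f : Prop :=
  exists2 mu : probability (borel X) R, invariant_measure f mu &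
    forall nu : probability (borel X) R, invariant_measure f nu ->
    forall A : set (borel X), measurable A -> nu A = mu A.

Definition separated f (n : nat) (eps : R) (E : {fset X}) : Prop :=
  {in E &, forall y z : X, y != z ->
    exists2 k : nat, (k < n)%N & eps < mdist (iter k f y) (iter k f z)}.

Definition max_separated f (n : nat) (eps : R) : \bar R :=
  ereal_sup [set (#|` E|%:R)%:E | E in [set E | separated f n eps E]].

(* Bowen's definition; the value of the sequence at [n = 0] is irrelevant. *)
Definition topological_entropy f : \bar R :=
  lim (limn_esup (fun n : nat => (n%:R^-1)%:E * lne (max_separated f n eps))%E
         @[eps --> 0^'+]).

Lemma max_separated_ge0 (f : X -> X) n (e : R) : (0 <= max_separated f n e)%E.
Proof.
by apply: ereal_sup_ubound; exists fset0; rewrite ?cardfs0// => y z; rewrite inE.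
Qed.

Lemma le_max_separated (f : X -> X) n (e1 e2 : R) :
  e1 <= e2 -> (max_separated f n e2 <= max_separated f n e1)%E.
Proof.
move=> e12; apply: le_ereal_sup => _ [E sE <-]; exists E => // y z yE zE yz.
by have [k kn H] := sE y z yE zE yz; exists k => //; exact: le_lt_trans H.
Qed.

(* The limit defining the entropy exists (it is monotone in [eps]). *)
Lemma topological_entropyE (f : X -> X) :
  topological_entropy f = ereal_sup
    [set limn_esup (fun n : nat => (n%:R^-1)%:E * lne (max_separated f n eps))%E
    | eps in [set` `]0%R, +oo[]].
Proof.
apply/cvg_lim => //; apply: nonincreasing_at_right_cvge => // e1 e2 _ _ e12.
rewrite /limn_esup !limf_esupE; apply: le_ereal_inf_tmp => _ [V FV <-].
apply: (@le_trans _ _ (ereal_sup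
  [set (n%:R^-1)%:E * lne (max_separated f n e2) | n in V])%E).
  by apply: ereal_inf_lbound; exists V.
apply: ge_ereal_sup => _ [n Vn <-].
apply: (@le_trans _ _ ((n%:R^-1)%:E * lne (max_separated f n e1))%E);
  last by apply: ereal_sup_ubound; exists n.
have n0 : (0 <= (n%:R^-1 : R)%:E)%E by rewrite lee_fin invr_ge0.
apply: (lee_wpmul2l n0).
by rewrite lee_lne ?in_itv/= ?max_separated_ge0 ?leey// le_max_separated.
Qed.

End Dynamics.

(* Main.v *)
(* If f is not rigid, points x_n with d(f^n x_n, x_n) > g, 1 <= n <= N, glued
   into one orbit give a segment y (a marker) such that two orbits following y
   with a delay between 1 and N separate. The gaps of a tracing orbit are not under
   control, but coding symbols by the length of successive copies of y makes
   different codes produce different delays. This gives positive entropy; and the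
   orbits of two constant codes drift past each other, so that the one cannot
   approximate the other and f is not minimal.

   If f is rigid, tracing x during a rigid time n and then y, and replacing f^n by
   the identity, shows that for every x, y some f^k x with k bounded stays close to
   y under all iterates. Hence f is minimal, every f^n is uniformly close to one of
   finitely many f^k, which yields equicontinuity, and any two orbits visit a closed
   set and its neighborhoods equally often up to a bounded error, which yields
   unique ergodicity. Equicontinuity bounds the cardinal of separated sets.

   Invariant measures come from the visit frequencies of an orbit along an
   ultrafilter, a finitely additive invariant content, by taking the outer measure
   defined by open covers. If the orbit of x avoids a neighborhood of y while some
   orbit traces y with bounded gaps, the two resulting measures differ. *)

Require Import Defs.
From HB Require Import structures.
From mathcomp Require Import all_boot all_order all_algebra finmap.
From mathcomp Require Import all_classical all_reals all_analysis measurable_realfun.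
From mathcomp Require Import zify ring lra.

Set Implicit Arguments.
Unset Strict Implicit.
Unset Printing Implicit Defensive.

Import Order.TTheory GRing.Theory Num.Theory.
Import numFieldNormedType.Exports.

Local Open Scope classical_set_scope.
Local Open Scope ring_scope.

(** * Metric preliminaries *)

Section Metric.
Context {R : realType} {X : pmetricType R}.
Implicit Types (f g : X -> X) (x y z : X).

Lemma mdist_near x (e : R) : 0 < e -> \forall y \near x, mdist x y < e.
Proof. by move=> e0; apply/metricType_numDomainType.nbhs_mdistP; exists e. Qed.

Lemma continuous_mdist f x (e : R) : continuous f -> 0 < e ->
  exists2 d : R, 0 < d & forall y, mdist x y < d -> mdist (f x) (f y) < e.
Proof.
move=> fc e0; have /metricType_numDomainType.nbhs_mdistP[d /= d0 H] :
    \forall y \near x, mdist (f x) (f y) < e.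
  exact: metricType_numDomainType.cvgr_dist_lt (fc x) _ e0.
by exists d => // y xy; exact: H.
Qed.

Lemma continuous_iter f n : continuous f -> continuous (iter n f).
Proof.
move=> fc; elim: n => [|n IH] x; first exact: cvg_id.
exact: (@continuous_comp _ _ _ (iter n f) f x (IH x) (fc _)).
Qed.

Lemma unif_continuous_mdist f (e : R) : compact [set: X] -> continuous f ->
  0 < e -> exists2 d : R, 0 < d &
  forall x y, mdist x y < d -> mdist (f x) (f y) < e.
Proof.
move=> cX fc e0.
have [d [d0 H]] : exists d : R, 0 < d /\
    [set: X] `<=` (fun x => forall y, mdist x y < d -> mdist (f x) (f y) < e).
  apply: (@filter_ex _ (0^'+)); near=> d.
  split; first by near: d; exact: nbhs_right_gt.
  (* The near-covering form of compactness turns a radius valid around each point into a uniform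
     one. *)
  near: d; move: cX => /compact_near_coveringP; apply => x _.
  have [d d0 xd] := continuous_mdist x fc (divr_gt0 e0 (ltr0n _ 2)).
  have d20 : 0 < d / 2 by rewrite divr_gt0.
  near=> x' r => y x'y /=.
  have xx' : mdist x x' < d / 2 by near: x'; exact: mdist_near.
  have rd : r < d / 2 by near: r; exact: nbhs_right_lt.
  apply: le_lt_trans (metric_triangle _ (f x) _) _.
  rewrite (splitr e) ltrD//.
    by rewrite metric_sym xd// (lt_trans xx')// ltr_pdivrMr// ltr_pMr// ltr1n.
  apply: xd; apply: le_lt_trans (metric_triangle _ x' _) _.
  by rewrite (splitr d) ltrD// (lt_trans x'y).
by exists d => // x y; exact: H.
Unshelve. all: by end_near. Qed.

Lemma unif_continuous_iter f (e : R) n :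
  compact [set: X] -> continuous f -> 0 < e -> exists2 d : R, 0 < d &
  forall k x y, (k < n)%N -> mdist x y < d ->
    mdist (iter k f x) (iter k f y) < e.
Proof.
move=> cX fc e0; elim: n => [|n [d d0 IH]]; first by exists 1.
have [d' d'0 H] := unif_continuous_mdist cX (@continuous_iter f n fc) e0.
exists (Num.min d d'); first by rewrite lt_min d0.
move=> k x y; rewrite ltnS leq_eqVlt lt_min => /predU1P[->|kn] /andP[xd xd'].
  exact: H.
exact: IH.
Qed.

Lemma minimal_mdist f : minimal_system f ->
  forall x y (e : R), 0 < e -> exists n, mdist (iter n f x) y < e.
Proof.
move=> fm x y e e0.
have [|z []] := fm x (interior (ball y e)) _ (open_interior _).
  by exists y; exact: nbhsx_ballx.
move=> /interior_subset; rewrite ballEmdist/= metric_sym => yz [n _ nz].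
by exists n; rewrite nz.
Qed.

Lemma minimal_mdistP f :
  (forall x y (e : R), 0 < e -> exists n, mdist (iter n f x) y < e) ->
  minimal_system f.
Proof.
move=> H x O [y Oy] oO.
have /metricType_numDomainType.nbhs_mdistP[e /= e0 yO] : nbhs y O.
  exact: open_nbhs_nbhs.
have [n xn] := H x y e e0; exists (iter n f x); split; last by exists n.
by apply: yO; rewrite /= metric_sym.
Qed.

Lemma uniformly_rigidP f : uniformly_rigid f <->
  forall e : R, 0 < e -> exists2 n, (0 < n)%N &
    forall x, mdist (iter n f x) x <= e.
Proof.
split=> [[n n0 ncvg] e e0|H].
  have /ncvg : nbhs (0%E : \bar R) [set z | (z < e%:E)%E].
    apply: open_nbhs_nbhs; split; last by rewrite /= lte_fin.
    exact: open_ereal_lt_ereal.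
  move=> [k _ /(_ k (leqnn k))/= /ltW ke]; exists (n k) => // x.
  by rewrite -lee_fin; apply: le_trans ke; apply: ereal_sup_ubound; exists x.
have /choice[n nH] : forall k : nat, exists n, (0 < n)%N /\
    forall x, mdist (iter n f x) x <= k.+1%:R^-1.
  by move=> k; have [|n] := H k.+1%:R^-1; [rewrite invr_gt0|exists n].
exists n => [k|]; first by have [] := nH k.
apply: (@squeeze_cvge _ _ _ _ (fun=> 0%E) _ (EFin \o harmonic)).
- near=> k; apply/andP; split.
    apply: (@le_trans _ _ (mdist (iter (n k) f point) point)%:E).
      by rewrite lee_fin mdist_ge0.
    by apply: ereal_sup_ubound; exists point.
  by apply: ge_ereal_sup => _ [x _ <-]; rewrite lee_fin; exact: (nH k).2.
- exact: cvg_cst.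
- exact: cvge_harmonic.
Unshelve. all: by end_near. Qed.

End Metric.

(** * Rigidity, markers and codes *)

Section Gluing.
Context {R : realType} {X : pmetricType R}.
Variable f : X -> X.
Implicit Types (x y z : X) (e : R).

Definition almost_period e n := forall x, mdist (iter n f x) x <= e.

(** Sequence-free form of [uniformly_rigid], by [uniformly_rigidP]. *)
Definition rigid := forall e, 0 < e -> exists2 n, (0 < n)%N & almost_period e n.

Definition shadows e L y z s :=
  forall l, (l < L)%N -> mdist (iter (s + l) f z) (iter l f y) <= e.

(** A gap of 1 lets the next segment start right where the previous one ends, so gaps in [1..M]
    amount to fewer than [M] idle steps. *)
Lemma gluing_starts e : gluing_orbit f -> 0 < e ->
  exists2 M, (0 < M)%N &
    forall (x : nat -> X) (m : nat -> nat), (forall j, (0 < m j)%N) ->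
    exists z (s : nat -> nat),
      [/\ s 0%N = 0%N, forall j, (s j + m j <= s j.+1 < s j + m j + M)%N &
      forall j, shadows e (m j) (x j) z (s j)].
Proof.
move=> /[apply] -[M M0 H]; exists M => // x m m0.
have [t [tM [z zt]]] := H x m m0; exists z, (trace_start m t); split => [|j|].
- by rewrite /trace_start big_ord0.
- rewrite /trace_start big_ord_recr/=.
  by have := m0 j; have := tM j; lia.
- by move=> j l; exact: zt.
Qed.

(** Over [N.+1] repetitions of an almost period of precision [e / N.+1], the displacements add up to
    at most [e]. *)
Lemma rigid_large e N : rigid -> 0 < e -> exists2 n, (N <= n)%N & almost_period e n.
Proof.
move=> fr e0; have e'0 : 0 < e / N.+1%:R by rewrite divr_gt0.
have [n n0 nH] := fr _ e'0; exists (N.+1 * n)%N; first by nia.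
move=> x; rewrite -[leRHS](@divfK _ N.+1%:R)// mulr_natr.
elim: {-2}N.+1 => [|q IH]; first by rewrite mul0n mdistxx.
rewrite mulSn iterD mulrS.
by apply: le_trans (metric_triangle _ (iter (q * n) f x) _) _; rewrite lerD.
Qed.

(** If every delay failed, all failures would occur within a bounded time, so finite segments of [x]
    and [y] suffice for a contradiction. *)
Lemma rigid_sync e : gluing_orbit f -> rigid -> 0 < e ->
  exists M, forall x y, exists2 k, (k < M)%N &
    forall l, mdist (iter (k + l) f x) (iter l f y) <= e.
Proof.
move=> fg fr e0; have e30 : 0 < e / 3 by rewrite divr_gt0.
have [M M0 H] := gluing_starts fg e30; exists M => x y.
apply: contrapT => /forall2NP nk.
have /choice[L HL] : forall k, exists l, (k < M)%N ->
    e < mdist (iter (k + l) f x) (iter l f y).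
  move=> k; have [kM|Mk] := ltnP k M; last by exists 0%N.
  have [//|/existsNP[l /negP]] := nk k; rewrite -ltNge => kl.
  by exists l.
pose L' := \max_(k < M) L k.
(* With this [n], the time [r + L r] still falls in the segment of [x], whatever the delay
   [r < M]. *)
have [n nM nH] := rigid_large (M + L').+1 fr e30.
pose m j := if j is 0%N then n else L'.+1.
have [|z [s [s0 sm zs]]] := H (fun j => if j is 0%N then x else y) m.
  by case=> //=; lia.
have := sm 0%N; rewrite s0 add0n /= => /andP[ns sn].
have [r s1r] : exists r, s 1%N = (n + r)%N by exists (s 1 - n)%N; lia.
have rM : (r < M)%N by lia.
have := HL r rM; apply/negP; rewrite -leNgt.
have LL' : (L r <= L')%N by exact: (leq_bigmax (Ordinal rM)).
have := zs 1%N (L r); rewrite /= ltnS s1r => /(_ LL') zy.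
have := zs 0%N (r + L r)%N; rewrite /= s0 add0n => zx.
have {}zx : mdist (iter (r + L r) f z) (iter (r + L r) f x) <= e / 3.
  by apply: zx; lia.
have := nH (iter (r + L r) f z); rewrite -iterD addnA => zz.
apply: le_trans (metric_triangle _ (iter (r + L r) f z) _) _.
have -> : e = e / 3 + (e / 3 + e / 3) by lra.
rewrite lerD//; first by rewrite metric_sym.
apply: le_trans (metric_triangle _ (iter (n + r + L r) f z) _) _.
by rewrite lerD// metric_sym.
Qed.

(* Two orbits that shadow the segment of length [L] of a marker with a delay
   between [1] and [N] are separated. *)
Definition marker e N L y := forall n, (0 < n <= N)%N ->
  exists2 a, (a + n < L)%N & 6 * e < mdist (iter a f y) (iter (a + n) f y).

(** With [n = q - p], at time [q + a] one orbit is near [iter (a + n) f y] and the other near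
    [iter a f y]; two tracing errors reduce [6 * e] to [4 * e]. *)
Lemma marker_separates e N L y z z' p q : marker e N L y ->
  shadows e L y z p -> shadows e L y z' q -> (p < q <= p + N)%N ->
  exists2 k, (k < q + L)%N & 4 * e < mdist (iter k f z) (iter k f z').
Proof.
move=> ym zp z'q pq; have [n qE] : exists n, q = (p + n)%N by exists (q - p)%N; lia.
have [|a aL ya] := ym n; first by lia.
exists (q + a)%N; first by lia.
have aL' : (a < L)%N by lia.
have := z'q a aL'; have := zp _ aL; rewrite qE addnCA addnC -!addnA (addnC a).
set u := iter _ f z; set v := iter _ f z' => uy vy.
have := metric_triangle (iter a f y) v (iter (a + n) f y).
have := metric_triangle v u (iter (a + n) f y).
rewrite (metric_sym _ v) (metric_sym v u) -(addnC n a) in ya *.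
move=> t1 t2.
lra.
Qed.

Lemma marker_exists : gluing_orbit f -> ~ rigid ->
  exists2 e, 0 < e & forall N, exists L y, marker e N L y.
Proof.
move=> fg /existsNP[g /not_implyP[g0 /forall2NP ng]].
have /choice[x Hx] : forall n, exists x, (0 < n)%N -> g < mdist (iter n f x) x.
  case=> [|n]; first by exists point.
  by have [//|/existsNP[x /negP]] := ng n.+1; rewrite -ltNge; exists x.
(* A displacement [g], eight times the precision, minus two tracing errors leaves the factor 6 of a
   marker. *)
have e0 : 0 < g / 8 by rewrite divr_gt0.
(* Length [j.+2] makes both times [0] and [j.+1] of the segment traced. *)
exists (g / 8) => // N; have [M M0 H] := gluing_starts fg e0.
have [|z [s [s0 sm zs]]] := H (fun j => x j.+1) (fun j => j.+2); first by [].
exists (\max_(k < N) s k + N.+1)%N, z => -[//|n] /= nN.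
have sn : (s n <= \max_(k < N) s k)%N by exact: (leq_bigmax (Ordinal nN)).
exists (s n); first by move: (\max_(k < N) s k) sn => ? sn; lia.
have := zs n 0%N; have := zs n n.+1; rewrite addn0 => /(_ (leqnn _)) z1 /(_ isT) z2.
have := Hx n.+1 isT.
have := metric_triangle (iter n.+1 f (x n.+1)) (iter (s n + n.+1) f z) (x n.+1).
have := metric_triangle (iter (s n + n.+1) f z) (iter (s n) f z) (x n.+1).
rewrite (metric_sym _ (iter (s n + n.+1) f z)).
rewrite (metric_sym (iter (s n + n.+1) f z) (iter (s n) f z)).
move: z1 z2 => /= z1 z2 t1 t2 t3; lra.
Qed.

(* A symbol is coded by the length of a shadowed segment. The two lengths differ
   by more than the gaps can make up for, so that codes which differ produce
   starts that differ. *)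
Lemma coding : gluing_orbit f -> ~ rigid ->
  exists e M L y, [/\ 0 < e, (0 < M)%N, marker e (3 * M) L y &
    forall c : nat -> bool, exists z (s : nat -> nat),
      [/\ s 0%N = 0%N,
       forall j, (s j + L + c j * (2 * M) <= s j.+1 < s j + L + c j * (2 * M) + M)%N
       & forall j, shadows e L y z (s j)]].
Proof.
move=> fg fr; have [e e0 He] := marker_exists fg fr.
have [M M0 HM] := gluing_starts fg e0.
(* After equal starts, the next starts differ by less than [M] for equal symbols, and by more than
   [M] but less than [3 * M] for different ones. *)
have [L [y my]] := He (3 * M)%N; exists e, M, L, y; split => // c.
have L0 : (0 < L)%N by have [|a aL _] := my 1%N; lia.
have [|z [s [s0 sm zs]]] := HM (fun=> y) (fun j => L + c j * (2 * M))%N.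
  by move=> j; lia.
exists z, s; split=> // [j|j l lL]; first by rewrite -addnA.
by apply: zs; lia.
Qed.

End Gluing.

(** * Minimality, equicontinuity and entropy *)

Section Consequences.
Context {R : realType} {X : pmetricType R}.
Variable f : X -> X.
Hypotheses (cX : compact [set: X]) (fc : continuous f) (fg : gluing_orbit f).
Implicit Types (x y z : X) (e : R).

(* Starts of the long code advance faster than those of the short code, by at
   most [3 * M] more per step, hence overtake them with a delay that the marker
   detects. *)
Lemma minimal_rigid : minimal_system f -> rigid f.
Proof.
move=> fm; apply: contrapT => /(coding fg)[e [M [L [y [e0 M0 my Hc]]]]].
have L0 : (0 < L)%N by have [|a aL _] := my 1%N; lia.
have [z [s [s0 ss zs]]] := Hc xpred0; have [z' [s' [s'0 ss' zs']]] := Hc xpredT.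
have {}ss j : (s j + L <= s j.+1 < s j + L + M)%N.
  by have := ss j; rewrite /= mul0n addn0.
have {}ss' j : (s' j + L + 2 * M <= s' j.+1 < s' j + L + 3 * M)%N.
  by have := ss' j; rewrite /= mul1n; lia.
(* A horizon beyond the end of the long-code segment that will be compared: its index is at most
   [L + M]. *)
pose T := ((L + M).+1 * (L + 3 * M) + L)%N.
have [d d0 dT] := unif_continuous_iter T cX fc (mulr_gt0 (ltr0n _ 4) e0).
have [u zu] := minimal_mdist fm z z' d0.
have /ex_minnP[i iu imin] : exists i, (u <= s i)%N.
  exists u; elim: u {zu} => // u IH.
  by have := ss u; lia.
have siu : (s i < u + (L + M))%N.
  case: i => [|i] in iu imin *; first by lia.
  by have := ss i; have := imin i; lia.
(* The long code gains at least [M.+1] per step, while its initial lag [s i - u] is below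
   [L + M]. *)
have drift j : (s (i + j) + j * M.+1 <= s' j + s i)%N.
  elim: j => [|j IH]; first by rewrite addn0; lia.
  by rewrite addnS mulSn; have := ss (i + j)%N; have := ss' j; lia.
have s'bound j : (s' j <= j * (L + 3 * M))%N.
  by elim: j => [|j IH]; rewrite ?s'0// mulSn; have := ss' j; lia.
(* At the first overtaking the delay is positive, and below [3 * M] since one step gains less than
   that. *)
have /ex_minnP[j ju jmin] : exists j, (s (i + j) < s' j + u)%N.
  by exists (L + M)%N; have := drift (L + M)%N; nia.
have jLM : (j <= L + M)%N by apply: jmin; have := drift (L + M)%N; nia.
case: j => [|j] in ju jmin jLM *; first by move: ju; rewrite addn0; lia.
have sju : (s' j + u <= s (i + j))%N by have := jmin j; lia.
have /= := ss (i + j)%N; rewrite -addnS => ssj.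
have ssu : (u <= s (i + j.+1))%N by lia.
have zp : shadows f e L y (iter u f z) (s (i + j.+1) - u)%N.
  by move=> l lL; rewrite -iterD addnAC subnK//; exact: zs.
have [|k kL] := marker_separates my zp (zs' j.+1).
  by have := ss' j; lia.
rewrite ltNge => /negP; apply; apply/ltW/dT => //.
have := s'bound j.+1; rewrite /T; nia.
Qed.

Lemma rigid_minimal : rigid f -> minimal_system f.
Proof.
move=> fr; apply: minimal_mdistP => x y e e0.
have [M /(_ x y)[k _ /(_ 0%N)]] := rigid_sync fg fr (divr_gt0 e0 (ltr0n _ 2)).
rewrite addn0 /= => xy; exists k; apply: le_lt_trans xy _.
by rewrite ltr_pdivrMr// ltr_pMr// ltr1n.
Qed.

(** Synchronizing [point] with [iter n f point] makes [iter k f] and [iter n f] close along the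
    orbit of [point], which is dense. The continuity modulus depends on [n], but the bound on [k]
    does not. *)
Lemma rigid_iter e : rigid f -> 0 < e -> exists M, forall n,
  exists2 k, (k < M)%N & forall x, mdist (iter k f x) (iter n f x) <= e.
Proof.
move=> fr e0; have e20 : 0 < e / 3 by rewrite divr_gt0.
have [M HM] := rigid_sync fg fr e20; exists M => n.
have [k kM Hk] := HM point (iter n f point); exists k => // x.
have [d d0 Hd] := unif_continuous_iter (maxn k n).+1 cX fc e20.
have [l lx] := minimal_mdist (rigid_minimal fr) point x d0.
have := Hk l; rewrite -iterD iterD (addnC l) iterD.
have := Hd k _ _ (leq_maxl _ _) lx; have := Hd n _ _ (leq_maxr _ _) lx.
set y := iter l f point => ny ky kny.
have := metric_triangle (iter k f x) (iter k f y) (iter n f x).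
have := metric_triangle (iter k f y) (iter n f y) (iter n f x).
by rewrite (metric_sym (iter k f x) (iter k f y)) => t1 t2; lra.
Qed.

Lemma rigid_equicontinuous : rigid f -> equicontinuous_system f.
Proof.
move=> fr e e0; have e30 : 0 < e / 3 by rewrite divr_gt0.
have [M HM] := rigid_iter fr e30; have [d d0 Hd] := unif_continuous_iter M cX fc e30.
exists d => // y z yz n; have [k kM kn] := HM n.
have := kn y; have := kn z; have := Hd _ _ _ kM yz => yz' nz ny.
have := metric_triangle (iter n f y) (iter k f y) (iter n f z).
have := metric_triangle (iter k f y) (iter k f z) (iter n f z).
by rewrite (metric_sym (iter n f y) (iter k f y)) => t1 t2; lra.
Qed.

(** Points in a common ball of radius [d / 2] are never separated, so a separated set injects into
    the centers of a finite cover. *)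
Lemma equicontinuous_bounded_separated e : 0 < e -> equicontinuous_system f ->
  exists N, forall n (E : {fset X}), Defs.separated f n e E -> (#|` E| <= N)%N.
Proof.
move=> e0 fe; have [d d0 Hd] := fe e e0.
have d20 : 0 < d / 2 by rewrite divr_gt0.
have := cX; rewrite compact_cover => /(_ X setT (fun x => interior (ball x (d / 2)))).
case=> [x _|x _|D _ cov].
- exact: open_interior.
- by exists x => //; exact: nbhsx_ballx.
exists #|` D| => n E Esep.
have /choice[g gD] : forall x, exists c, c \in D /\ mdist c x < d / 2.
  move=> x; have [//|c /= cD /interior_subset] := cov x.
  by rewrite ballEmdist /=; exists c.
have ginj : {in E &, injective g}.
  move=> x y xE yE gxy; apply/eqP/negP => /negP xy.
  have [k _] := Esep x y xE yE xy; apply/negP; rewrite -leNgt ltW//.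
  apply: Hd; apply: le_lt_trans (metric_triangle _ (g x) _) _.
  rewrite (splitr d); apply: ltrD; [rewrite metric_sym|rewrite gxy]; exact: (gD _).2.
have <- : #|` [fset g x | x in E]%fset| = #|` E| by exact: card_in_imfset.
apply: fsubset_leq_card; apply/fsubsetP => c.
by move=> /imfsetP[x _ ->]; exact: (gD x).1.
Qed.

Lemma equicontinuous_entropy : equicontinuous_system f ->
  topological_entropy f = 0%E.
Proof.
move=> fe; rewrite topological_entropyE.
suff H e : 0 < e -> limn_esup (fun n =>
    ((n%:R^-1)%:E * lne (max_separated f n e))%E) = 0%E.
  rewrite -[RHS](@ereal_sup1 R 0%E); congr ereal_sup; apply/seteqP; split.
    by move=> _ /= [e /[!in_itv]/= /andP[e0 _] <-]; exact: H.
  by move=> _ /= ->; exists 1; [rewrite /= in_itv/= ltr01|exact: H].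
move=> e0; have [N HN] := equicontinuous_bounded_separated e0 fe.
have max1 n : (1 <= max_separated f n e)%E.
  apply: ereal_sup_ubound; exists [fset point]%fset; last by rewrite cardfs1.
  by move=> x y; rewrite !inE => /eqP-> /eqP->; rewrite eqxx.
have maxN n : (max_separated f n e <= N.+1%:R%:E)%E.
  by apply: ge_ereal_sup => _ [E /HN EN <-]; rewrite lee_fin ler_nat leqW.
have invn : (fun n => n%:R^-1 : R) @ \oo --> (0 : R).
  by rewrite -cvg_shiftS; exact: cvg_harmonic.
have lnN : (fun n => n%:R^-1 * ln N.+1%:R : R) @ \oo --> (0 : R).
  by rewrite -(mul0r (ln N.+1%:R)); apply: cvgM; [exact: invn|exact: cvg_cst].
have cvg0 : (fun n => ((n%:R^-1)%:E * lne (max_separated f n e))%E) @ \oo --> 0%E.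
  apply: (@squeeze_cvge _ _ _ _ (fun=> 0%E) _
    (fun n => (n%:R^-1)%:E * lne N.+1%:R%:E))%E.
  - near=> n; have n0 : (0 <= (n%:R^-1 : R)%:E)%E by rewrite lee_fin.
    apply/andP; split; first by rewrite mule_ge0 ?lne_ge0.
    apply: lee_wpmul2l => //.
    rewrite lee_lne ?maxN// in_itv/= ?leey ?andbT ?max_separated_ge0// ?lee_fin.
  - exact: cvg_cst.
  - under eq_fun do rewrite lne_EFin// -EFinM.
    by apply: cvg_EFin => //; exact: nearW.
by rewrite is_cvg_limn_esupE; [apply/cvg_lim|apply/cvg_ex; exists 0%E].
Unshelve. all: by end_near. Qed.

(* If at most [P] steps of time are spent per symbol, [k] symbols yield [2 ^ k]
   orbits that are separated within time [k.+1 * P]. *)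
Lemma zero_entropy_rigid : topological_entropy f = 0%E -> rigid f.
Proof.
move=> f0; apply: contrapT => /(coding fg)[e [M [L [y [e0 M0 my Hc]]]]].
have L0 : (0 < L)%N by have [|a aL _] := my 1%N; lia.
have /choice[z /choice[s Hz]] := Hc.
pose P := (L + 3 * M)%N.
have sP c j : (s c j <= j * P)%N.
  have [s0 ss _] := Hz c; elim: j => [|j IH]; first by rewrite s0.
  by have := ss j; rewrite /P mulSn in IH *; case: (c j) => /=; lia.
have sepP k c c' : (exists2 i, (i < k)%N & c i != c' i) ->
    exists2 l, (l < k.+1 * P)%N & 4 * e < mdist (iter l f (z c)) (iter l f (z c')).
  move=> [i ik cc']; apply: contrapT => nsep.
  have [s0 ss zs] := Hz c; have [s'0 ss' zs'] := Hz c'.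
  (* Without separation the starts agree inductively, as any difference would be a delay that the
     marker detects; the differing symbol then contradicts equality at [i.+1]. *)
  suff H j : (j <= k)%N -> s c j = s c' j.
    have := H _ ik; have := H _ (ltnW ik); have := ss i; have := ss' i.
    by move: cc'; case: (c i); case: (c' i) => //= _; lia.
  elim: j => [|j IH] jk; first by rewrite s0 s'0.
  have {IH} IH := IH (ltnW jk).
  have sk : (s c j.+1 + L <= k.+1 * P)%N.
    by have := sP c j.+1; rewrite /P; nia.
  have sk' : (s c' j.+1 + L <= k.+1 * P)%N.
    by have := sP c' j.+1; rewrite /P; nia.
  have := ss j; have := ss' j; rewrite -{}IH => sj' sj.
  have [lt|gt|//] := ltngtP (s c j.+1) (s c' j.+1); exfalso; apply: nsep.
    have [|l lL lsep] := marker_separates my (zs j.+1) (zs' j.+1).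
      by move: sj sj'; case: (c j); case: (c' j) => /=; lia.
    by exists l => //; lia.
  have [|l lL lsep] := marker_separates my (zs' j.+1) (zs j.+1).
    by move: sj sj'; case: (c j); case: (c' j) => /=; lia.
  by exists l; [lia|rewrite metric_sym].
have sep2 k : ((2 ^ k)%:R%:E <= max_separated f (k.+1 * P) e)%E.
  (* Words are extended by [false] beyond their length. *)
  pose code (w : {ffun 'I_k -> bool}) i := oapp w false (insub i).
  have codeP w w' : w != w' -> exists2 i, (i < k)%N & code w i != code w' i.
    move=> ww'; have [i wi] : exists i, w i != w' i.
      apply: contrapT => /forallNP ww'i; move/eqP: ww'; apply; apply/ffunP => i.
      by apply/eqP/negPn/negP; exact: ww'i.
    by exists i => //; rewrite /code valK.
  pose E := [fset z (code w) | w in {: {ffun 'I_k -> bool}}]%fset.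
  have -> : (2 ^ k)%N = #|` E|.
    rewrite card_imfset/=; first by rewrite -cardT card_ffun card_bool card_ord.
    move=> w w' ww'; apply/eqP/negPn/negP => /codeP/sepP[l _].
    by rewrite ww' mdistxx; lra.
  apply: ereal_sup_ubound; exists E => // _ _ /imfsetP[w _ ->] /imfsetP[w' _ ->] ww'.
  have [|l lk lsep] := sepP _ _ _ (codeP w w' _).
    by apply: contra_neq ww' => ->.
  by exists l => //; apply: lt_trans lsep; lra.
have P0 : (0 < P)%N by rewrite /P; lia.
(* The growth rate is [ln 2 / P] times [k / k.+1], which is at least one half for positive [k]. *)
pose h : R := ln 2 / (2 * P%:R).
have h0 : 0 < h by rewrite divr_gt0 ?mulr_gt0 ?ltr0n// ln_gt0// ltr1n.
suff : (h%:E <= topological_entropy f)%E by rewrite f0 lee_fin leNgt h0.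
rewrite topological_entropyE; apply: (@le_trans _ _ (limn_esup (fun n =>
    ((n%:R^-1)%:E * lne (max_separated f n e))%E))); last first.
  by apply: ereal_sup_ubound; exists e => //; rewrite /= in_itv/= e0.
rewrite /limn_esup limf_esupE; apply: le_ereal_inf_tmp => _ [V [n0 _ n0V] <-].
pose k := n0.+1; pose n := (k.+1 * P)%N.
apply: (@le_trans _ _ ((n%:R^-1)%:E * lne (max_separated f n e))%E); last first.
  by apply: ereal_sup_ubound; exists n => //; apply: n0V; rewrite /= /n /k; nia.
apply: (@le_trans _ _ ((n%:R^-1)%:E * lne (2 ^ k)%:R%:E)%E); last first.
  apply: lee_wpmul2l; first by rewrite lee_fin.
  by rewrite lee_lne ?sep2// in_itv/= leey ?max_separated_ge0// lee_fin ler0n.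
rewrite lne_EFin ?ltr0n ?expn_gt0// -EFinM lee_fin natrX lnXn ?ltr0n//.
rewrite -(mulr_natr (ln 2)) /n /h natrM.
have k2 : (k.+1%:R : R) <= 2 * k%:R by rewrite -natrM ler_nat /k; lia.
have ln2 : 0 < ln (2 : R) by rewrite ln_gt0// ltr1n.
have PR : 0 < (P%:R : R) by rewrite ltr0n.
have kR : 0 < (k.+1%:R : R) by rewrite ltr0n.
have -> : (k.+1%:R * P%:R)^-1 * (ln 2 * k%:R) =
    ln 2 / (2 * P%:R) * (2 * k%:R / k.+1%:R) :> R.
  by field; rewrite !gt_eqF.
by rewrite ler_peMr ?(ltW h0)// ler_pdivlMr// mul1r.
Qed.

End Consequences.

(** * Visit frequencies along an ultrafilter *)

Section Frequency.
Context {R : realType} {T : Type}.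
Variables (U : set_system nat) (f : T -> T) (z : T).
Hypotheses (UF : UltraFilter U) (Uoo : \oo `<=` U).

Let PU : ProperFilter U := ultra_proper.

(** Compactness of the segment provides a cluster point, and an ultrafilter converges to its cluster
    points. *)
Lemma ultra_cvg (u : nat -> R) (a b : R) : (forall n, a <= u n <= b) ->
  cvg (u @ U).
Proof.
move=> uab; have [|p [_ Up]] := @segment_compact R a b (u @ U) _.
  by apply: nearW => n; rewrite /= in_itv/= uab.
apply/cvg_ex; exists p => V pV.
have [//|UVc] := in_ultra_setVsetC (u @^-1` V) UF.
by have [x []] := Up (~` V) V UVc pV.
Qed.

Definition visits (A : set T) n : nat := \sum_(i < n) `[< A (iter i f z) >].

Lemma visitsS A n : visits A n.+1 = (visits A n + `[< A (iter n f z) >])%N.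
Proof. by rewrite /visits big_ord_recr. Qed.

Lemma visits_le A n : (visits A n <= n)%N.
Proof.
elim: n => [|n IH]; first by rewrite /visits big_ord0.
by rewrite visitsS -[n.+1]addn1 leq_add// leq_b1.
Qed.

Lemma visits_sub A B n : A `<=` B -> (visits A n <= visits B n)%N.
Proof.
move=> AB; apply: leq_sum => i _; case: asboolP => // /AB Bi.
by rewrite asboolT.
Qed.

Lemma visitsU A B n : A `&` B = set0 ->
  visits (A `|` B) n = (visits A n + visits B n)%N.
Proof.
move=> AB0; rewrite /visits -big_split; apply: eq_bigr => i _ /=.
rewrite asbool_or; have : ~ (A (iter i f z) /\ B (iter i f z)).
  by move=> ABi; suff : set0 (iter i f z) by []; rewrite -AB0.
by case: asboolP => // ?; case: asboolP => // ? [].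
Qed.

(** Shifting the time window changes only its two end terms. *)
Lemma visits_preimage A n :
  (visits (f @^-1` A) n + `[< A z >] = visits A n + `[< A (iter n f z) >])%N.
Proof.
elim: n => [|n IH]; first by rewrite /visits !big_ord0.
by rewrite !visitsS addnAC IH.
Qed.

Lemma visitsT n : visits setT n = n.
Proof.
by elim: n => [|n IH]; rewrite ?visitsS ?IH ?asboolT ?addn1// /visits big_ord0.
Qed.

Definition freq (A : set T) n : R := (visits A n)%:R / n%:R.

(** The ultrafilter makes the limit exist for every subset, measurable or not. *)
Definition ufreq (A : set T) : R := lim (freq A @ U).

Lemma freq_ge0 A n : 0 <= freq A n. Proof. by rewrite divr_ge0. Qed.

Lemma cvg_ufreq A : freq A @ U --> ufreq A.
Proof.
apply: (@ultra_cvg _ 0 1) => n; rewrite freq_ge0/=.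
by case: n => [|n]; rewrite /freq ?invr0 ?mulr0// ler_pdivrMr// mul1r ler_nat visits_le.
Qed.

Lemma ufreq_ge0 A : 0 <= ufreq A.
Proof.
by apply: (cvgr_to_ge (@cvg_ufreq A)); apply: nearW => n; exact: freq_ge0.
Qed.

Lemma ufreq_sub A B : A `<=` B -> ufreq A <= ufreq B.
Proof.
move=> AB; apply: ler_lim; [exact: cvg_ufreq|exact: cvg_ufreq|].
by apply: nearW => n; rewrite ler_wpM2r// ler_nat visits_sub.
Qed.

Lemma ufreqU A B : A `&` B = set0 -> ufreq (A `|` B) = ufreq A + ufreq B.
Proof.
move=> AB0; apply: cvg_lim => //.
rewrite (_ : freq _ = freq A \+ freq B); first by apply: cvgD; exact: cvg_ufreq.
by apply/funext => n; rewrite /freq/= visitsU// natrD mulrDl.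
Qed.

Lemma cvg_Uoo (u : nat -> R) (l : R) : u @ \oo --> l -> u @ U --> l.
Proof. by move=> ul V /ul; exact: Uoo. Qed.

Lemma cvg_invn : (fun n => n%:R^-1 : R) @ U --> (0 : R).
Proof. by apply: cvg_Uoo; rewrite -cvg_shiftS; exact: cvg_harmonic. Qed.

Lemma ufreqT : ufreq setT = 1.
Proof.
apply: cvg_lim => //; apply: cvg_Uoo; apply: cvg_near_cst.
by exists 1%N => // n /= n0; rewrite /freq visitsT divff// pnatr_eq0 -lt0n.
Qed.

Lemma ufreq_preimage A : ufreq (f @^-1` A) = ufreq A.
Proof.
apply: cvg_lim => //.
have -> : freq (f @^-1` A) = freq A \+
    (fun n => (`[< A (iter n f z) >]%:R - `[< A z >]%:R) * n%:R^-1).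
  apply/funext => n; rewrite /freq/= -mulrDl; congr (_ / _).
  by rewrite addrA -natrD -visits_preimage natrD addrK.
rewrite -[ufreq A]addr0; apply: cvgD; first exact: cvg_ufreq.
apply: (@squeeze_cvgr _ _ _ _ (fun n => - n%:R^-1) (fun n => n%:R^-1)).
- apply: nearW => n; rewrite -ler_norml normrM (@ger0_norm _ n%:R^-1)// ler_piMl//.
  by case: `[< _ >]; case: `[< _ >]; rewrite ?subrr ?subr0 ?sub0r ?normrN ?normr0 ?normr1.
- by rewrite -oppr0; apply: cvgN; exact: cvg_invn.
- exact: cvg_invn.
Qed.

Lemma ufreq_eq0 A : (forall n, ~ A (iter n f z)) -> ufreq A = 0.
Proof.
move=> An; apply: cvg_lim => //; rewrite (_ : freq A = fun=> 0); first exact: cvg_cst.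
apply/funext => n; rewrite /freq (_ : visits A n = 0%N) ?mul0r//.
by rewrite /visits big1// => i _; rewrite asboolF.
Qed.

Lemma ufreq_ge A M : (0 < M)%N -> (forall n, n <= visits A n * M)%N ->
  M%:R^-1 <= ufreq A.
Proof.
move=> M0 AM; apply: (cvgr_to_ge (@cvg_ufreq A)); apply: Uoo.
exists 1%N => // n /= n0; rewrite /freq ler_pdivlMr ?ltr0n// mulrC.
by rewrite ler_pdivrMr ?ltr0n// -natrM ler_nat.
Qed.

End Frequency.

(** * Borel measures from finitely additive contents *)

Section Neighborhoods.
Context {R : realType} {X : pmetricType R}.
Implicit Types (C : set X) (e : R).

Definition nbd C e : set X := \bigcup_(c in C) [set x | mdist c x < e].

Lemma open_nbd C e : open (nbd C e).
Proof.
rewrite openE => x [c Cc /= cx]; apply/metricType_numDomainType.nbhs_mdistP.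
exists (e - mdist c x); rewrite /= ?subr_gt0// => y xy; exists c => //=.
by apply: le_lt_trans (metric_triangle _ x _) _; rewrite addrC -ltrBrDr.
Qed.

Lemma sub_nbd C e : 0 < e -> C `<=` nbd C e.
Proof. by move=> e0 x Cx; exists x; rewrite //= mdistxx. Qed.

Lemma nbd_sub C e1 e2 : e1 <= e2 -> nbd C e1 `<=` nbd C e2.
Proof. by move=> e12 x [c Cc /= cx]; exists c => //=; exact: lt_le_trans e12. Qed.

Lemma closure_nbd C e1 e2 : e1 < e2 -> closure (nbd C e1) `<=` nbd C e2.
Proof.
move=> e12 x /(_ [set y | mdist x y < e2 - e1]); case.
  by apply: mdist_near; rewrite subr_gt0.
move=> y [[c Cc /= cy] /= xy]; exists c => //=.
apply: le_lt_trans (metric_triangle _ y _) _.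
by rewrite (metric_sym y); lra.
Qed.

Lemma nbd_closed C : closed C ->
  C = \bigcap_n nbd C n.+1%:R^-1.
Proof.
move=> Cc; apply/seteqP; split=> [x Cx n _|x Cx]; first exact: sub_nbd.
apply: Cc => V /metricType_numDomainType.nbhs_mdistP[e /= e0 eV].
have [n ne] := filter_ex (near_infty_natSinv_lt (PosNum e0)).
have [c Cc /= cx] := Cx n I; exists c; split => //; apply: eV => /=.
by rewrite metric_sym (lt_trans cx).
Qed.

End Neighborhoods.

Section OuterMeasure.
Context {R : realType} {X : pmetricType R}.
Variable nu : set X -> R.
Hypotheses (cX : compact [set: X]) (nu0 : nu set0 = 0) (nu_ge0 : forall A, 0 <= nu A)
  (nu_sub : forall A B, A `<=` B -> nu A <= nu B)
  (nuU : forall A B, A `&` B = set0 -> nu (A `|` B) = nu A + nu B).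

(* Infinite outside the open sets, so that the outer measure extending it is
   computed from covers by open sets. *)
Definition open_content (A : set (borel X)) : \bar R :=
  if `[< open (A : set X) >] then (nu A)%:E else +oo%E.

Definition outer : set (borel X) -> \bar R := mu_ext open_content.

Let open_content0 : open_content set0 = 0%E.
Proof. by rewrite /open_content asboolT ?nu0//; exact: open0. Qed.

Let open_content_ge0 A : (0 <= open_content A)%E.
Proof. by rewrite /open_content; case: asboolP; rewrite ?lee_fin ?leey. Qed.

HB.instance Definition _ := isOuterMeasure.Build R (borel X) outer
  (mu_ext0 open_content0 open_content_ge0)
  (mu_ext_ge0 open_content_ge0)
  (le_mu_ext open_content)
  (mu_ext_sigma_subadditive open_content_ge0).

Lemma outer_le_series (U : nat -> set X) (A : set X) :
  (forall n, open (U n)) -> A `<=` \bigcup_n U n ->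
  (outer A <= \sum_(n <oo) (nu (U n))%:E)%E.
Proof.
move=> Uo AU; apply: ereal_inf_lbound; exists U.
  by split=> // n; exact: sub_sigma_algebra.
by apply: eq_eseriesr => n _; rewrite /open_content asboolT.
Qed.

Lemma outer_le (U : set X) : open U -> (outer U <= (nu U)%:E)%E.
Proof.
move=> Uo; pose V n := if n is 0%N then U else set0.
apply: le_trans (@outer_le_series V _ _ _) _.
- by case=> [|n]//; exact: open0.
- by move=> x Ux; exists 0%N.
rewrite nneseries_recl => [|n|]//; last by rewrite lee_fin.
by rewrite eseries0 ?adde0// => -[|n]// _ _; rewrite /= nu0.
Qed.

(** A cover with a member that is not open has infinite total content. *)
Lemma outer_ge (A : set X) (c : \bar R) :
  (forall U : nat -> set X, (forall n, open (U n)) -> A `<=` \bigcup_n U n ->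
    (c <= \sum_(n <oo) (nu (U n))%:E)%E) ->
  (c <= outer A)%E.
Proof.
move=> H; apply: le_ereal_inf_tmp => _ [U [_ AU] <-].
have [Uo|/existsNP[n Un]] := pselect (forall n, open (U n : set X)).
  apply: le_trans (H U Uo AU) _; apply: lee_nneseries => n *.
    by rewrite lee_fin.
  by rewrite /open_content asboolT.
have Unoo : open_content (U n) = +oo%E by rewrite /open_content asboolF.
rewrite (eseries_pinfty _ _ Unoo) ?leey// => i _.
by rewrite -ltNye (lt_le_trans _ (open_content_ge0 _)).
Qed.

Lemma nu_bigcup_le (U : nat -> set X) n :
  nu (\big[setU/set0]_(i < n) U i) <= \sum_(i < n) nu (U i).
Proof.
elim: n => [|n IH]; first by rewrite !big_ord0 nu0.
rewrite !big_ord_recr/=; set V := \big[setU/set0]_(i < n) U i in IH *.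
have -> : V `|` U n = V `|` (U n `\` V).
  apply/seteqP; split=> x [Vx|]; [by left| |by left|by case; right].
  by have [Vx|nVx] := pselect (V x); [left|right].
by rewrite nuU ?setDIK// lerD// nu_sub.
Qed.

(** A finite subcover reduces the bound to finite subadditivity of [nu]. *)
Lemma outer_closed_ge (C : set X) : closed C -> ((nu C)%:E <= outer C)%E.
Proof.
move=> Cc; apply: outer_ge => U Uo CU.
have := subclosed_compact Cc cX (@subsetT _ C).
rewrite compact_cover => /(_ nat setT U)[//|//|D _ CD].
pose N := (\max_(i <- D) i).+1.
apply: (@le_trans _ _ (\sum_(i < N) nu (U i))%:E).
  rewrite lee_fin; apply: le_trans (nu_bigcup_le _ _); apply: nu_sub.
  move=> x /CD[i /= iD Ui]; rewrite -bigcup_mkord; exists i => //=.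
  by rewrite ltnS; apply: leq_bigmax_seq.
rewrite -sumEFin -(big_mkord xpredT (fun i => (nu (U i))%:E)).
by apply: nneseries_lim_ge => n *; rewrite lee_fin.
Qed.

(* Finite additivity of [nu] bounds the measure of the layers between the
   neighborhoods of a closed set by a telescoping sum. *)
Lemma outer_caratheodory (C : set X) : closed C -> outer.-caratheodory C.
Proof.
move=> Cc; apply: le_caratheodory_measurable => A.
pose G n := nbd C n.+1%:R^-1 : set X.
have Gdec n m : (n <= m)%N -> G m `<=` G n.
  by move=> nm; apply: nbd_sub; rewrite lef_pV2 ?posrE// ler_nat.
have clG n : closure (G n.+1) `<=` G n.
  by apply: closure_nbd; rewrite ltf_pV2 ?posrE// ltr_nat.
have clo n : open (~` closure (G n)) by exact/closed_openC/closed_closure.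
(* Each open set of a cover is split into its part in [G n.+1] and its part off the closure; these
   are disjoint, so [nu] adds up. *)
have far n : (outer (A `&` C) + outer (A `\` G n) <= outer A)%E.
  apply: outer_ge => U Uo AU.
  have V1 : (outer (A `&` C) <= \sum_(i <oo) (nu (U i `&` G n.+1))%:E)%E.
    apply: outer_le_series => [i|x [/AU[i _ Ui] Cx]].
      by apply: openI => //; exact: open_nbd.
    by exists i => //; split => //; exact: sub_nbd.
  have V2 : (outer (A `\` G n) <= \sum_(i <oo) (nu (U i `\` closure (G n.+1)))%:E)%E.
    apply: outer_le_series => [i|x [/AU[i _ Ui] nGx]].
      by rewrite setDE; exact: openI.
    by exists i => //; split => // /clG.
  apply: le_trans (leeD V1 V2) _.
  rewrite -nneseriesD; last 2 first.
    by move=> i _ _; rewrite lee_fin.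
    by move=> i _ _; rewrite lee_fin.
  apply: lee_nneseries => [i _ _|i _]; first by rewrite -EFinD lee_fin addr_ge0.
  rewrite -EFinD lee_fin -nuU; first by apply: nu_sub => x [[]|[]].
  by apply/seteqP; split=> // x [[_ Gx] [_]]; apply; exact: subset_closure.
pose l := inf (range (fun n => nu (G n))).
have l_le n : l <= nu (G n).
  by apply: ge_inf; [exists 0 => _ [k _ <-]|exists n].
have layers n : (outer (G n `\` C) <= (2 * (nu (G n) - l))%:E)%E.
  (* Removing the closure two indices further keeps the layers open and lets them overlap enough to
     cover. The sum telescopes by steps of two, hence the factor 2. *)
  pose O k := G (n + k)%N `\` closure (G (n + k).+2).
  have GO : G n `\` C `<=` \bigcup_k O k.
    move=> x [Gx nCx].
    have /ex_minnP[p] : exists p, `[< ~ G p x >].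
      apply: contrapT => /forallNP nG; apply: nCx.
      rewrite (nbd_closed Cc) => p _; apply: contrapT => Gpx.
      by apply: (nG p); exact/asboolP.
    move=> /asboolP Gp pmin; have np : (n < p)%N.
      by rewrite ltnNge; apply/negP => /Gdec/(_ _ Gx).
    exists (p.-1 - n)%N => //; rewrite /O subnKC; last by lia.
    split; last by move=> /clG; rewrite prednK//; lia.
    apply: contrapT => Gp1; have := pmin p.-1; rewrite asboolT// => /(_ isT); lia.
  apply: le_trans (le_outer_measure outer _ _ GO) _.
  apply: le_trans (outer_measure_sigma_subadditive outer O) _.
  apply: (@le_trans _ _ (\sum_(k <oo) (nu (O k))%:E)%E).
    apply: lee_nneseries => [k _ _|k _]; first exact: outer_measure_ge0.
    by apply: outer_le; rewrite /O setDE; exact: openI (open_nbd _ _) (clo _).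
  apply: lime_le; first by apply: is_cvg_nneseries => *; rewrite lee_fin.
  apply: nearW => N; rewrite sumEFin lee_fin.
  have Ok k : nu (O k) <= nu (G (n + k)%N) - nu (G (n + k).+2).
    rewrite lerBrDr -nuU; first by apply: nu_sub => x [[]//|]; apply: Gdec; lia.
    by apply/seteqP; split=> // x [[_ +] Gx]; apply; exact: subset_closure.
  have : \sum_(0 <= k < N) nu (O k) <=
      nu (G n) + nu (G n.+1) - nu (G (n + N)%N) - nu (G (n + N).+1).
    elim: N => [|N IH]; first by rewrite big_nil addn0; lra.
    by rewrite big_nat_recr//= addnS; have := Ok N; lra.
  have := l_le (n + N)%N; have := l_le (n + N).+1.
  have := nu_sub (Gdec _ _ (leqnSn n)); lra.
apply/lee_addgt0Pr => e e0; have e20 : 0 < e / 2 by rewrite divr_gt0.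
have [|_ [n _ <-] Gl] := @inf_adherent _ (range (fun n => nu (G n))) _ e20.
  by split; [exists (nu (G 0%N)), 0%N|exists 0 => _ [k _ <-]].
have AC : A `&` ~` C `<=` (A `\` G n) `|` (G n `\` C).
  by move=> x [Ax nCx]; have [Gx|nGx] := pselect (G n x); [right|left].
apply: (@le_trans _ _ (outer (A `&` C) + (outer (A `\` G n) + outer (G n `\` C)))%E).
  apply: leeD => //; apply: le_trans (le_outer_measure outer _ _ AC) _.
  exact: outer_measureU2.
rewrite addeA leeD// (le_trans (layers n))// lee_fin.
by move: Gl; rewrite -/l; lra.
Qed.

(** A separate name to carry the measure structure, [outer] being an outer measure. *)
Definition borel_outer (A : set (borel X)) : \bar R := outer A.

Lemma borel_caratheodory (A : set (borel X)) :
  measurable A -> outer.-caratheodory A.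
Proof.
move: A; apply: smallest_sub.
  exact: (@sigma_algebra_measurable _ (caratheodory_type outer)).
move=> U Uo; rewrite -(setCK U); apply: caratheodory_measurable_setC.
exact/outer_caratheodory/open_closedC.
Qed.

Let borel_outer_sigma_additive : semi_sigma_additive borel_outer.
Proof.
move=> F mF tF _; apply: caratheodory_measure_sigma_additive => //.
  by move=> i; exact: borel_caratheodory.
by apply: caratheodory_measurable_bigcup => i; exact: borel_caratheodory.
Qed.

HB.instance Definition _ := isMeasure.Build _ (borel X) R borel_outer
  (outer_measure0 outer) (outer_measure_ge0 outer) borel_outer_sigma_additive.

Hypothesis nuT : nu setT = 1.

Let borel_outerT : borel_outer setT = 1%E.
Proof.
apply/eqP; rewrite eq_le -nuT outer_le ?outer_closed_ge//.
exact: openT.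
Qed.

HB.instance Definition _ :=
  Measure_isProbability.Build _ (borel X) R borel_outer borel_outerT.

Lemma content_probability : exists mu : probability (borel X) R,
  forall A, mu A = outer A.
Proof. by exists borel_outer. Qed.

End OuterMeasure.

(** * Invariant measures *)

Section InvariantMeasures.
Context {R : realType} {X : pmetricType R}.
Variable f : X -> X.
Hypotheses (cX : compact [set: X]) (fc : continuous f).
Implicit Types (mu : probability (borel X) R) (A : set (borel X)).

Lemma open_preimage_iter n (U : set X) : open U -> open (iter n f @^-1` U).
Proof. by move=> Uo; apply: open_comp => // x _; exact: continuous_iter. Qed.

Lemma borel_open (U : set X) : open U -> measurable (U : set (borel X)).
Proof. by move=> Uo; exact: sub_sigma_algebra. Qed.

Lemma borel_closed (C : set X) : closed C -> measurable (C : set (borel X)).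
Proof.
by move=> Cc; rewrite -(setCK C); apply: measurableC; apply: borel_open; exact: closed_openC.
Qed.

Lemma borel_preimage A : measurable A -> measurable (f @^-1` A : set (borel X)).
Proof.
move=> mA; rewrite -[_ @^-1` _]setTI.
have : measurable_fun setT (f : borel X -> borel X).
  apply: (@measurability _ _ (borel X) (borel X) setT f (@open X) erefl).
  move=> _ [U Uo <-].
  by rewrite setTI; apply: borel_open; exact: open_preimage_iter 1 _ Uo.
exact.
Qed.

Lemma invariant_preimage_iter mu n A : invariant_measure f mu -> measurable A ->
  measurable (iter n f @^-1` A : set (borel X)) /\ mu (iter n f @^-1` A) = mu A.
Proof.
move=> inv mA; elim: n => [//|n [mn <-]].
rewrite (_ : iter n.+1 f @^-1` A = f @^-1` (iter n f @^-1` A)); last first.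
  by apply/funext => x; rewrite /preimage/= -iterS iterSr.
by split; [exact: borel_preimage|exact: inv].
Qed.

(* Krylov-Bogolyubov along the orbit of [z]. *)
Lemma orbit_measure (z : X) : exists2 mu : probability (borel X) R,
  invariant_measure f mu &
  (forall U : set X, open U -> (forall n, ~ U (iter n f z)) -> mu U = 0%E) /\
  (forall (C : set X) M, closed C -> (0 < M)%N ->
    (forall n, n <= visits f z C n * M)%N -> (M%:R^-1%:E <= mu C)%E).
Proof.
have [U [UF Uoo]] := @ultraFilterLemma _ \oo _.
pose nu := @ufreq R X U f z.
have nu0 : nu set0 = 0 by apply: ufreq_eq0 => n [].
have nu_ge0 A : 0 <= nu A by exact: ufreq_ge0.
have nu_sub A B : A `<=` B -> nu A <= nu B by exact: ufreq_sub.
have nuU A B : A `&` B = set0 -> nu (A `|` B) = nu A + nu B by exact: ufreqU.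
have nuT : nu setT = 1 by exact: ufreqT.
have [mu muE] := content_probability cX nu0 nu_ge0 nu_sub nuU nuT.
(* Preimages of an open cover of [A] cover the preimage of [A], with the same total content. *)
have mu_le A : (mu (f @^-1` A) <= mu A)%E.
  rewrite !muE; apply: outer_ge => // V Vo AV.
  have -> : (\sum_(n <oo) (nu (V n))%:E = \sum_(n <oo) (nu (f @^-1` V n))%:E)%E.
    by apply: eq_eseriesr => n _; rewrite /nu ufreq_preimage.
  apply: outer_le_series => [n|x /AV[n _ Vn]]; last by exists n.
  exact: (@open_preimage_iter 1).
exists mu => [A mA|].
  apply/eqP; rewrite eq_le mu_le/=.
  have mfA := borel_preimage mA.
  (* Passing to complements reverses the inequality, as the total mass is 1. *)
  have := mu_le (~` A); rewrite preimage_setC !probability_setC//.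
  rewrite -(fineK (fin_num_measure mu _ mA)) -(fineK (fin_num_measure mu _ mfA)).
  by rewrite -!EFinB !lee_fin; lra.
split=> [V Vo Vz|C M Cc M0 CM].
  apply/eqP; rewrite eq_le measure_ge0 andbT muE.
  by rewrite (le_trans (outer_le nu0 nu_ge0 Vo))// lee_fin /nu ufreq_eq0.
rewrite muE; apply: le_trans (outer_closed_ge cX nu0 nu_ge0 nu_sub nuU Cc).
by rewrite lee_fin; exact: ufreq_ge.
Qed.

Lemma visitsE n (A : set X) :
  (fun x => (visits f x A n)%:R%:E : \bar R) =
  (fun x => \sum_(i < n) (\1_(iter i f @^-1` A) x)%:E)%E.
Proof.
apply/funext => x; rewrite sumEFin /visits natr_sum.
by congr _%:E; apply: eq_bigr => i _; rewrite indicE in_setE.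
Qed.

Let measurable_indic_iter mu n A : invariant_measure f mu -> measurable A ->
  measurable_fun [set: borel X] (fun x => (\1_(iter n f @^-1` A) x)%:E : \bar R).
Proof.
move=> inv mA; apply/measurable_EFinP/measurable_indic.
by have [] := invariant_preimage_iter n inv mA.
Qed.

Lemma measurable_visits mu n A : invariant_measure f mu -> measurable A ->
  measurable_fun [set: borel X] (fun x => (visits f x A n)%:R%:E : \bar R).
Proof.
move=> inv mA; rewrite visitsE; apply: emeasurable_sum => i.
exact: measurable_indic_iter inv mA.
Qed.

Lemma integral_visits mu n A : invariant_measure f mu -> measurable A ->
  (\int[mu]_x (visits f x A n)%:R%:E = n%:R%:E * mu A)%E.
Proof.
move=> inv mA; rewrite visitsE ge0_integral_sum//; last first.
  by move=> i; exact: measurable_indic_iter inv mA.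
under eq_bigr => i _.
  have [mi mui] := invariant_preimage_iter i inv mA.
  rewrite integral_indic//= setIT mui. over.
by rewrite sumr_const card_ord mule_natl.
Qed.

Lemma visitsD (x : X) (A : set X) m n :
  visits f x A (m + n) = (visits f x A m + visits f (iter m f x) A n)%N.
Proof.
elim: n => [|n IH]; first by rewrite !addn0 /visits big_ord0 addn0.
by rewrite addnS !visitsS IH addnA -iterD (addnC n).
Qed.

Lemma visits_mono (x : X) (A : set X) m n :
  (m <= n)%N -> (visits f x A m <= visits f x A n)%N.
Proof. by move=> /subnKC <-; rewrite visitsD leq_addr. Qed.

Lemma visits_shift (x : X) (A : set X) k n :
  (visits f (iter k f x) A n <= k + visits f x A n)%N.
Proof.
apply: (@leq_trans (visits f x A (k + n))); first by rewrite visitsD leq_addl.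
by rewrite addnC visitsD addnC leq_add2r visits_le.
Qed.

(** * Unique ergodicity of rigid systems *)

Section Uniqueness.
Hypotheses (fg : gluing_orbit f) (fr : rigid f).

(* The visits of any two orbits to [C] and to a neighborhood of [C] compare up
   to a bounded delay. *)
Lemma invariant_closed_le_nbd mu nu (C : set X) (e : R) :
  invariant_measure f mu -> invariant_measure f nu -> closed C -> 0 < e ->
  (mu C <= nu (nbd C e))%E.
Proof.
move=> imu inu Cc e0; set V := nbd C e.
have mC : measurable (C : set (borel X)) by exact: borel_closed.
have mV : measurable (V : set (borel X)) by apply: borel_open; exact: open_nbd.
have [M HM] := rigid_sync fg fr (divr_gt0 e0 (ltr0n _ 2)).
have vis x y n : (visits f y C n <= M + visits f x V n)%N.
  have [k kM Hk] := HM x y.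
  apply: (@leq_trans (k + visits f x V n)); last by rewrite leq_add2r ltnW.
  apply: leq_trans (visits_shift x V k n); apply: leq_sum => i _.
  case: asboolP => // Ci; rewrite asboolT//; exists (iter i f y) => //=.
  rewrite metric_sym -iterD addnC (le_lt_trans (Hk i))//.
  by rewrite ltr_pdivrMr// ltr_pMr// ltr1n.
(* The bound is integrated first over [y] against [mu], then over [x] against [nu]. *)
have le1 n x : (n%:R%:E * mu C <= (M + visits f x V n)%:R%:E)%E.
  rewrite -integral_visits//.
  apply: (@le_trans _ _ (\int[mu]_y (M + visits f x V n)%:R%:E)%E).
    apply: ge0_le_integral => //.
    - exact: measurable_visits imu mC.
    - by move=> y _; rewrite lee_fin ler_nat.
  by rewrite integral_cst//= probability_setT mule1.
have le2 n : (n%:R%:E * mu C <= M%:R%:E + n%:R%:E * nu V)%E.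
  rewrite -(integral_visits n inu mV).
  have -> : (M%:R%:E = \int[nu]_x M%:R%:E :> \bar R)%E.
    by rewrite integral_cst//= probability_setT mule1.
  rewrite -ge0_integralD//; last exact: measurable_visits inu mV.
  apply: (@le_trans _ _ (\int[nu]_y (n%:R%:E * mu C))%E).
    by rewrite integral_cst//= probability_setT mule1.
  apply: ge0_le_integral => //.
  - by move=> y _; rewrite mule_ge0.
  - apply: emeasurable_funD => //; exact: measurable_visits inu mV.
  - by move=> y _; rewrite -EFinD -natrD.
move: le2; rewrite -(fineK (fin_num_measure mu _ mC)).
rewrite -(fineK (fin_num_measure nu _ mV)); set a := fine _; set b := fine _ => le2.
rewrite lee_fin leNgt; apply/negP => ba.
have ab0 : 0 < a - b by rewrite subr_gt0.
(* For [n] beyond [M / (a - b)], the linear gap exceeds the bounded error [M]. *)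
have := le2 (Num.truncn (M%:R / (a - b))).+1.
rewrite -!EFinM -EFinD lee_fin -lerBlDr -mulrBr -ler_pdivlMr// leNgt => /negP; apply.
by rewrite truncnS_gt.
Qed.

Lemma invariant_closed_le mu nu (C : set X) :
  invariant_measure f mu -> invariant_measure f nu -> closed C ->
  (mu C <= nu C)%E.
Proof.
move=> imu inu Cc.
have mnbd n : measurable (nbd C n.+1%:R^-1 : set (borel X)).
  by apply: borel_open; exact: open_nbd.
have nucvg : nu (nbd C n.+1%:R^-1) @[n --> \oo] --> nu C.
  rewrite [in X in _ --> X](nbd_closed Cc); apply: nonincreasing_cvg_mu => //.
  - by rewrite ltey_eq fin_num_measure.
  - by rewrite -(nbd_closed Cc); exact: borel_closed.
  - move=> m n mn; apply/subsetPset/nbd_sub.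
    by rewrite lef_pV2 ?posrE// ler_nat.
rewrite -(cvg_lim _ nucvg)//; apply: lime_ge; first by apply/cvg_ex; exists (nu C).
by apply: nearW => n; exact: invariant_closed_le_nbd.
Qed.

(** Comparison both ways gives equality on closed sets, hence on open sets, which are stable under
    intersection and generate. *)
Lemma invariant_unique mu nu : invariant_measure f mu -> invariant_measure f nu ->
  forall A, measurable A -> mu A = nu A.
Proof.
move=> imu inu A mA.
apply: (@measure_unique _ R (borel X) (@open X) (fun=> setT)) => //.
- exact: openI.
- by move=> _; exact: openT.
- by rewrite bigcup_const.
- move=> U Uo; have mU : measurable (U : set (borel X)) by exact: borel_open.
  have setCE (m : probability (borel X) R) : m U = (1 - m (~` U))%E.
    by have := probability_setC m (measurableC mU); rewrite setCK.
  apply: (etrans (setCE mu)); apply: (etrans _ (esym (setCE nu))).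
  congr (_ - _)%E; apply/eqP; rewrite eq_le.
  by rewrite !invariant_closed_le//; exact: open_closedC.
- by move=> _; rewrite ltey_eq fin_num_measure.
Qed.

Lemma rigid_uniquely_ergodic : uniquely_ergodic f.
Proof.
have [mu imu _] := orbit_measure point; exists mu => // nu inu A mA.
exact: invariant_unique.
Qed.

End Uniqueness.

Lemma uniquely_ergodic_minimal :
  gluing_orbit f -> uniquely_ergodic f -> minimal_system f.
Proof.
move=> fg [mu imu muU]; apply: minimal_mdistP => x y e e0.
apply: contrapT => /forallNP nxy.
have e20 : 0 < e / 2 by rewrite divr_gt0.
have [M M0 HM] := gluing_starts fg e20.
have [//|z [s [s0 ss zs]]] := HM (fun=> y) (fun=> 1%N).
(* The factor [3 / 4] leaves room above the tracing error [e / 2] and below the radius [e] that the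
   orbit of [x] avoids. *)
pose C := closure (nbd [set y] (3 / 4 * e)).
have CU : C `<=` nbd [set y] e by apply: closure_nbd; lra.
have zC j : C (iter (s j) f z).
  apply: subset_closure; exists y => //=; have := zs j 0%N isT.
  by rewrite addn0 metric_sym => /le_lt_trans; apply; lra.
have sM j : (s j <= j * M)%N.
  by elim: j => [|j IH]; rewrite ?s0// mulSn; have := ss j; lia.
have sN j : (j < visits f z C (s j).+1)%N.
  elim: j => [|j IH]; rewrite visitsS asboolT//; first by rewrite addn1.
  by rewrite addn1 ltnS (leq_trans IH)// visits_mono//; have := ss j; lia.
have [m1 im1 [m1U _]] := orbit_measure x.
have [m2 im2 [_ m2C]] := orbit_measure z.
have Cc : closed C by exact: closed_closure.
have mC : measurable (C : set (borel X)) by exact: borel_closed.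
have m10 : m1 C = 0%E.
  apply/eqP; rewrite eq_le measure_ge0 andbT.
  rewrite -(m1U (nbd [set y] e) (open_nbd _ _)).
    by apply: le_measure => //; rewrite inE//; apply: borel_open; exact: open_nbd.
  by move=> n [_ -> /=]; rewrite metric_sym; exact: nxy.
have : (M%:R^-1%:E <= m2 C)%E.
  (* The start of index [n %/ M] is at most [n], so more than [n %/ M] visits occur by time
     [n.+1]. *)
  apply: m2C => // -[//|n]; have := ltn_ceil n M0; have := sN (n %/ M)%N.
  have : (visits f z C (s (n %/ M)).+1 <= visits f z C n.+1)%N.
    by apply: visits_mono; rewrite ltnS (leq_trans (sM _))// leq_trunc_div.
  nia.
by rewrite (muU m2)// -(muU m1)// m10 lee_fin leNgt invr_gt0 ltr0n M0.
Qed.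

End InvariantMeasures.

Theorem theorem1p2 (R : realType) (X : pmetricType R) (f : X -> X)
    (Xinfinite : infinite_set [set: X]) (Xcompact : compact [set: X])
    (fcont : continuous f) (fglue : gluing_orbit f) :
  [<-> topological_entropy f = 0%E;
       minimal_system f;
       equicontinuous_system f;
       uniformly_rigid f;
       uniquely_ergodic f].
Proof.
have minimal_equi : minimal_system f -> equicontinuous_system f.
  by move=> fm; apply: rigid_equicontinuous => //; exact: minimal_rigid.
have equi_rigid : equicontinuous_system f -> rigid f.
  by move=> fe; apply: zero_entropy_rigid => //; exact: equicontinuous_entropy.
tfae.
- by move=> /zero_entropy_rigid fr; apply: rigid_minimal => //; exact: fr.
- exact: minimal_equi.
- by move=> /equi_rigid fr; apply/uniformly_rigidP.
- by move=> /uniformly_rigidP fr; exact: rigid_uniquely_ergodic.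
- move=> fu; apply: equicontinuous_entropy => //; apply: minimal_equi.
  exact: uniquely_ergodic_minimal.
Qed.
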